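(* The chromatic number of the class of signed hexagonal grids is $4$; that is, every signed hexagonal grid $G$ satisfies $\chi_s(G)\le 4$, and some signed hexagonal grid has $\chi_s(G)=4$.
   Context: A signed graph $G=(V,E,s)$ is a finite simple graph (no loops, no parallel edges) with a signature $s:E\to\{-1,+1\}$ (positive and negative edges). Switching a vertex $v$ reverses the sign of every edge incident to $v$. A homomorphism of signed graphs $G\to H$ is a map $\varphi:V(G)\to V(H)$ such that, after switching some subset of the vertices of $G$, every edge $uv$ of $G$ is mapped to an edge $\varphi(u)\varphi(v)$ of $H$ with the same sign. The chromatic number $\chi_s(G)$ of a signed graph $G$ is the minimum order of a signed graph $H$ such that $G$ admits a homomorphism to $H$; the chromatic number of a class of signed graphs is the maximum of the chromatic numbers of its members. A hexagonal grid is a finite induced subgraph of the (infinite) graph of the tiling of the plane by regular hexagons; a signed hexagonal grid is a hexagonal grid with an arbitrary signature. *)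

(* Defs.v *)
From mathcomp Require Import all_boot all_order all_algebra.
From mathcomp Require Import boolp.
Set Implicit Arguments.
Unset Strict Implicit.
Unset Printing Implicit Defensive.
Import Order.TTheory GRing.Theory Num.Theory.

(* [sneg u v] says that the edge uv is negative; its value on pairs that are
   not edges is irrelevant and is never used. *)
Record signed_graph := SignedGraph {
  svertex :> finType;
  sedge : rel svertex;
  sneg : rel svertex;
  sedge_sym : symmetric sedge;
  sedge_irr : irreflexive sedge;
  sneg_sym : symmetric sneg
}.
Arguments sedge {s} _ _.
Arguments sneg {s} _ _.

Section Switching.
Variables (G : signed_graph) (S : {set G}).

(* Switching every vertex of S: an edge with both ends in S is reversed twice. *)
Definition switch_neg : rel G :=
  fun u v => sneg u v (+) (u \in S) (+) (v \in S).

Lemma switch_neg_sym : symmetric switch_neg.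
Proof. by move=> u v; rewrite /switch_neg sneg_sym addbAC. Qed.

Definition switch : signed_graph :=
  SignedGraph (@sedge_sym G) (@sedge_irr G) switch_neg_sym.

End Switching.

Definition sign_preserving (G H : signed_graph) (phi : G -> H) : Prop :=
  forall u v : G, sedge u v ->
    sedge (phi u) (phi v) /\ sneg (phi u) (phi v) = sneg u v.

Definition signed_hom (G H : signed_graph) (phi : G -> H) : Prop :=
  exists S : {set G}, @sign_preserving (switch S) H phi.

Definition hom_to_order (G : signed_graph) (k : nat) : Prop :=
  exists H : signed_graph, #|H| = k /\ exists phi : G -> H, signed_hom phi.

Lemma hom_to_order_ex (G : signed_graph) : exists k, `[< hom_to_order G k >].
Proof.
exists #|G|; apply/asboolP; exists G; split=> //; exists id, set0 => u v uv.
by split=> //; rewrite /= /switch_neg !in_set0 !addbF.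
Qed.

Definition chi_s (G : signed_graph) : nat := ex_minn (hom_to_order_ex G).

Definition class_chromatic_number (C : signed_graph -> Prop) (k : nat) : Prop :=
  (forall G, C G -> chi_s G <= k) /\ (exists G, C G /\ chi_s G = k).

(* Tiling of the plane by regular hexagons of side 1.  The pair (a, b) stands
   for the point a e1 + b e2, where e1 and e2 are unit vectors at an angle of
   60 degrees.  The hexagon centres form the lattice spanned by e1 + e2 and its
   image 2 e2 - e1 under the rotation by 60 degrees, both of length sqrt 3; the
   corners of the hexagon centred at c are the c + r^k e1, where r is that
   rotation and k is taken modulo 6. *)
Definition plane_point : Type := (int * int)%type.

Local Open Scope ring_scope.

Definition rot60 (p : plane_point) : plane_point := (- p.2, p.1 + p.2).

Definition hex_center (i j : int) : plane_point := (i - j, i + 2 * j).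

Definition hex_corner (i j : int) (k : nat) : plane_point :=
  let c := hex_center i j in
  let d := iter k rot60 (1, 0) in
  (c.1 + d.1, c.2 + d.2).

Definition hex_vertex (p : plane_point) : Prop :=
  exists i j k, p = hex_corner i j k.

Definition hex_adj (p q : plane_point) : Prop :=
  exists i j k,
    (p = hex_corner i j k /\ q = hex_corner i j k.+1) \/
    (q = hex_corner i j k /\ p = hex_corner i j k.+1).

Definition hexagonal_grid (V : finType) (e : rel V) : Prop :=
  exists pos : V -> plane_point,
    [/\ injective pos,
        forall v, hex_vertex (pos v)
      & forall u v, e u v <-> hex_adj (pos u) (pos v)].

Definition signed_hexagonal_grid (G : signed_graph) : Prop :=
  hexagonal_grid (@sedge G).

(* Main.v *)
Require Import Defs.
From mathcomp Require Import all_boot all_algebra boolp zify.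
Set Implicit Arguments.
Unset Strict Implicit.
Unset Printing Implicit Defensive.

(** Upper bound: let the target be K4 with a single negative edge, in which any
    two vertices are joined by walks of length three of both signs.  Drawn as a
    brick wall, the hexagonal grid is mapped row by row and, in each row, from
    left to right: every step extends the map along a path of length three with
    both ends already mapped.

    Lower bound: a signed graph of order at most three can be switched so that
    all its edges have the same sign, hence its closed walks of even length are
    positive.  Homomorphisms preserve the sign of closed walks, so a hexagon
    with exactly one negative edge has no homomorphism to such a graph. *)

Lemma chi_s_leq (G : signed_graph) (k : nat) : hom_to_order G k -> chi_s G <= k.
Proof.
by move=> Gk; rewrite /chi_s; case: ex_minnP => m _; apply; apply/asboolP.
Qed.

Lemma hom_to_order_chi_s (G : signed_graph) : hom_to_order G (chi_s G).
Proof. by rewrite /chi_s; case: ex_minnP => m /asboolP. Qed.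

(** * Signs of walks *)

Fixpoint walk_neg (G : signed_graph) (x : G) (p : seq G) : bool :=
  if p is y :: p' then sneg x y (+) walk_neg y p' else false.

Lemma walk_neg_switch (G : signed_graph) (S : {set G}) (x : G) (p : seq G) :
  @walk_neg (switch S) x p = walk_neg x p (+) (x \in S) (+) (last x p \in S).
Proof.
elim: p x => [|y p IHp] x /=; first by rewrite addbb.
rewrite IHp /switch_neg.
by case: (y \in S); case: (x \in S); case: (_ \in S); case: sneg; case: walk_neg.
Qed.

Lemma walk_neg_switch_closed (G : signed_graph) (S : {set G}) (x : G) (p : seq G) :
  last x p = x -> @walk_neg (switch S) x p = walk_neg x p.
Proof. by move=> px; rewrite walk_neg_switch px addbK. Qed.

Lemma sign_preserving_walk (G H : signed_graph) (phi : G -> H) (x : G) (p : seq G) :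
    sign_preserving phi -> path sedge x p ->
  path sedge (phi x) (map phi p) /\ walk_neg (phi x) (map phi p) = walk_neg x p.
Proof.
move=> phiP; elim: p x => [|y p IHp] x //= /andP[/phiP[-> ->] /IHp[-> ->]].
by split.
Qed.

Lemma signed_hom_closed_walk (G H : signed_graph) (phi : G -> H)
    (x : G) (p : seq G) :
    signed_hom phi -> path sedge x p -> last x p = x ->
  path sedge (phi x) (map phi p) /\ walk_neg (phi x) (map phi p) = walk_neg x p.
Proof.
move=> [S phiP] xp px; rewrite -(walk_neg_switch_closed S px).
exact: (@sign_preserving_walk (switch S)).
Qed.

Lemma walk_neg_const (G : signed_graph) (t : bool) (x : G) (p : seq G) :
    (forall u v : G, sedge u v -> sneg u v = t) -> path sedge x p ->
  walk_neg x p = t && odd (size p).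
Proof.
move=> negt; elim: p x => [|y p IHp] x /=; first by rewrite andbF.
by move=> /andP[/negt-> /IHp->]; case: (t); case: odd.
Qed.

Lemma card_le3_neq_pair (T : finType) (r u v x : T) :
  #|T| <= 3 -> u != r -> v != r -> u != v -> x != r -> x = u \/ x = v.
Proof.
move=> T3 ur vr uv xr; apply/pred2P; apply: contraLR T3.
rewrite negb_or -ltnNge => /andP[xu xv].
suff <- : #|[set x; u; v; r]| = 4 by exact: max_card.
by rewrite -!setUA !cardsU1 cards1 !inE !negb_or xr xu xv ur vr uv.
Qed.

(* The first switch makes all edges at r positive; switching r as well then
   makes all edges negative if the remaining edge is so. *)
Lemma order_le3_switch_const (G : signed_graph) :
  #|G| <= 3 -> exists (S : {set G}) (t : bool),
    forall u v : G, u != v -> switch_neg S u v = t.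
Proof.
move=> G3; have [r _|G0] := pickP (@predT G); last first.
  by exists set0, false => u; have := G0 u.
pose neg u v := sneg u v (+) sneg r u (+) sneg r v.
have neg_sym u v : neg u v = neg v u by rewrite /neg sneg_sym addbAC.
pose t := [exists u, exists v, [&& u != r, v != r, u != v & neg u v]].
have negE u v : u != r -> v != r -> u != v -> neg u v = t.
  move=> ur vr uv; apply/idP/existsP => [nuv|[x /existsP[y /and4P[xr yr xy nxy]]]].
    by exists u; apply/existsP; exists v; rewrite ur vr uv nuv.
  have third := card_le3_neq_pair G3 ur vr uv.
  case: (third x xr) (third y yr) xy nxy => -> [] ->; rewrite ?eqxx // => _.
  by rewrite neg_sym.
exists [set u | if u == r then t else sneg r u], t => u v.
rewrite /switch_neg !inE; have [->|ur] := eqVneq u r; have [->|vr] := eqVneq v r.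
- by [].
- by rewrite addbAC addbb.
- by rewrite sneg_sym addbb.
- exact: negE.
Qed.

Lemma order_le3_even_closed_walk (G : signed_graph) (x : G) (p : seq G) :
    #|G| <= 3 -> path sedge x p -> last x p = x -> ~~ odd (size p) ->
  walk_neg x p = false.
Proof.
move=> /order_le3_switch_const[S [t St]] xp px even_p.
rewrite -(walk_neg_switch_closed S px) (@walk_neg_const (switch S) t) //.
  by rewrite (negPf even_p) andbF.
by move=> u v uv; apply: St; apply: contraTneq uv => ->; rewrite sedge_irr.
Qed.

Lemma negative_even_closed_walk_chi_s (G : signed_graph) (x : G) (p : seq G) :
    path sedge x p -> last x p = x -> ~~ odd (size p) -> walk_neg x p ->
  3 < chi_s G.
Proof.
move=> xp px even_p; rewrite ltnNge; apply: contraL.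
have [H [<- [phi homphi]]] := hom_to_order_chi_s G => H3.
have [phixp <-] := signed_hom_closed_walk homphi xp px.
by rewrite order_le3_even_closed_walk ?size_map // last_map px.
Qed.

(** * Double switching graphs *)

Section DoubleSwitch.
Variable H : signed_graph.

Definition double_switch_edge : rel (H * bool) := fun x y => sedge x.1 y.1.

Definition double_switch_neg : rel (H * bool) :=
  fun x y => sneg x.1 y.1 (+) x.2 (+) y.2.

Lemma double_switch_edge_sym : symmetric double_switch_edge.
Proof. by move=> x y; apply: sedge_sym. Qed.

Lemma double_switch_edge_irr : irreflexive double_switch_edge.
Proof. by move=> x; apply: sedge_irr. Qed.

Lemma double_switch_neg_sym : symmetric double_switch_neg.
Proof. by move=> x y; rewrite /double_switch_neg sneg_sym addbAC. Qed.

Definition double_switch : signed_graph :=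
  SignedGraph double_switch_edge_sym double_switch_edge_irr double_switch_neg_sym.

Lemma double_switch_signed_hom (G : signed_graph) (f : G -> double_switch) :
  sign_preserving f -> signed_hom (fun v => (f v).1).
Proof.
move=> fP; exists [set v | (f v).2] => u v /fP[uv fuv]; split=> //.
rewrite /= /switch_neg !inE -fuv /= /double_switch_neg.
by case: (f u).2; case: (f v).2; rewrite !(addbF, addbT) ?negbK.
Qed.

End DoubleSwitch.

Definition signed_adj (G : signed_graph) (s : bool) (x y : G) : bool :=
  sedge x y && (sneg x y == s).

Lemma signed_adjC (G : signed_graph) (s : bool) (x y : G) :
  signed_adj s x y = signed_adj s y x.
Proof. by rewrite /signed_adj sedge_sym sneg_sym. Qed.

Definition both_sign_walks3 (H : signed_graph) : Prop :=
  forall (x y : H) (s : bool), exists u v,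
    path sedge x [:: u; v; y] /\ walk_neg x [:: u; v; y] = s.

Definition all_signs_walks3 (H : signed_graph) : Prop :=
  forall (s1 s2 s3 : bool) (x y : H), exists u v,
    [/\ signed_adj s1 x u, signed_adj s2 u v & signed_adj s3 v y].

Lemma double_switch_all_signs_walks3 (H : signed_graph) :
  both_sign_walks3 H -> all_signs_walks3 (double_switch H).
Proof.
move=> H3 s1 s2 s3 [x a] [y b].
have [u [v [/and4P[xu uv vy _]]]] := H3 x y (s1 (+) s2 (+) s3 (+) a (+) b).
rewrite /= addbF => walkE.
exists (u, sneg x u (+) a (+) s1), (v, sneg v y (+) b (+) s3).
rewrite /signed_adj /= /double_switch_edge /double_switch_neg /= xu uv vy.
split; first by rewrite addKb eqxx.
- apply/eqP; move: walkE; case: (sneg u v); case: (sneg x u); case: (sneg v y);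
    by case: a; case: b; case: s1; case: s2; case: s3.
- by rewrite addbAC addKb eqxx.
Qed.

(** * K4 with one negative edge *)

Definition K4_edge : rel (bool * bool) := fun x y => x != y.

(* The only negative edge joins (true, false) and (true, true). *)
Definition K4_neg : rel (bool * bool) := fun x y => x.1 && y.1.

Lemma K4_edge_sym : symmetric K4_edge.
Proof. by move=> x y; rewrite /K4_edge eq_sym. Qed.

Lemma K4_edge_irr : irreflexive K4_edge.
Proof. by move=> x; rewrite /K4_edge eqxx. Qed.

Lemma K4_neg_sym : symmetric K4_neg.
Proof. by move=> x y; rewrite /K4_neg andbC. Qed.

Definition K4 : signed_graph := SignedGraph K4_edge_sym K4_edge_irr K4_neg_sym.

Lemma K4_both_sign_walks2 (x y : K4) (s : bool) : x.1 != y.1 ->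
  exists u, path sedge x [:: u; y] /\ walk_neg x [:: u; y] = s.
Proof.
(* The other two vertices give walks of opposite signs, as exactly one of the
   four edges involved is negative. *)
case: x y => [a b] [c d] /= ac.
exists (if a == s then (a, ~~ b) else (c, ~~ d)).
by case: a b c d s ac => [] [] [] [] [].
Qed.

Lemma K4_both_sign_walks3 : both_sign_walks3 K4.
Proof.
move=> x y s; pose v : K4 := (~~ x.1, ~~ y.2).
have xv : x.1 != v.1 by rewrite /v /=; case: (x.1).
have vy : v != y by rewrite -pair_eqE /= negb_and orbC; case: (y.2).
have [u [/= /and3P[xu uv _]]] := K4_both_sign_walks2 (s (+) sneg v y) xv.
rewrite addbF => signE; exists u, v; rewrite /= xu uv /= addbF addbA signE addbK.
by split=> //; rewrite andbT.
Qed.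

(** * Brick walls *)

Lemma indexed_dependent_choice (T : Type) (P : nat -> T -> Prop)
    (R : nat -> T -> T -> Prop) :
  (exists x, P 0 x) ->
  (forall n x, P n x -> exists y, P n.+1 y /\ R n x y) ->
  exists f : nat -> T, forall n, P n (f n) /\ R n (f n) (f n.+1).
Proof.
move=> /cid[x0 Px0] step.
pose next n (s : {x | P n x}) : {y | P n.+1 y /\ R n (sval s) y} :=
  cid (step n (sval s) (svalP s)).
pose fix f n : {x | P n x} := if n is m.+1
  then exist _ (sval (next m (f m))) (svalP (next m (f m))).1
  else exist _ x0 Px0.
exists (fun n => sval (f n)) => n; split; first exact: svalP.
exact: (svalP (next n (f n))).2.
Qed.

Definition brick_edge (p q : nat * nat) : Prop :=
  q = (p.1.+1, p.2) \/ (q = (p.1, p.2.+1) /\ odd p.1 = odd p.2).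

Definition brick_adj (p q : nat * nat) : Prop := brick_edge p q \/ brick_edge q p.

Section BrickWallMap.
Variable D : signed_graph.
Hypothesis D_walks3 : all_signs_walks3 D.
Variable x0 : D.

(* The invariant at a column without a vertical edge asks for one step of
   lookahead, since the next column has such an edge. *)
Lemma brick_row_map (o : bool) (below : nat -> D) (horiz vert : nat -> bool) :
  exists row : nat -> D, forall c,
    signed_adj (horiz c) (row c) (row c.+1) /\
    (odd c = o -> signed_adj (vert c) (below c) (row c)).
Proof.
pose linked c x := signed_adj (vert c) (below c) x.
pose extendable c x := if odd c == o then is_true (linked c x)
  else exists y, signed_adj (horiz c) x y && linked c.+1 y.
have [||row rowP] :=
  @indexed_dependent_choice D extendable (fun c => signed_adj (horiz c)).
- have [x [y [bx xy yb]]] :=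
    D_walks3 (vert 0) (horiz 0) (vert 1) (below 0) (below 1).
  exists x; rewrite /extendable; case: ifP => _ //.
  by exists y; rewrite xy /linked signed_adjC.
- move=> c x; rewrite /extendable /=.
  have [<- _ | co [y /andP[xy ylinked]]] := eqVneq (odd c) o.
    have [y [z [xy yz zb]]] :=
      D_walks3 (horiz c) (horiz c.+1) (vert c.+2) x (below c.+2).
    exists y; split=> //; rewrite ifF; last by case: odd.
    by exists z; rewrite yz /linked signed_adjC.
  by exists y; split=> //; rewrite ifT //; move: co; case: odd; case: (o).
- exists row => c; have [ext step] := rowP c; split=> // co.
  by move: ext; rewrite /extendable co eqxx.
Qed.

Lemma brick_wall_map (neg : rel (nat * nat)) :
  exists f : nat * nat -> D,
    forall p q, brick_edge p q -> signed_adj (neg p q) (f p) (f q).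
Proof.
have [||f fP] := @indexed_dependent_choice (nat -> D)
  (fun r f => forall c, signed_adj (neg (c, r) (c.+1, r)) (f c) (f c.+1))
  (fun r f g => forall c, odd c = odd r ->
     signed_adj (neg (c, r) (c, r.+1)) (f c) (g c)).
- have [row rowP] := brick_row_map true (fun=> x0)
    (fun c => neg (c, 0) (c.+1, 0)) (fun=> false).
  by exists row => c; case: (rowP c).
- move=> r f _; have [row rowP] := brick_row_map (odd r) f
    (fun c => neg (c, r.+1) (c.+1, r.+1)) (fun c => neg (c, r) (c, r.+1)).
  by exists row; split=> c; case: (rowP c).
exists (fun p => f p.2 p.1) => -[c r] q [-> | [-> cr]] /=; have [row col] := fP r.
  exact: row.
exact: col.
Qed.

Lemma brick_wall_hom (G : signed_graph) (pos : G -> nat * nat) :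
    injective pos -> (forall u v, sedge u v -> brick_adj (pos u) (pos v)) ->
  exists f : G -> D, sign_preserving f.
Proof.
move=> pos_inj posP.
pose neg p q := [exists u, exists v, [&& pos u == p, pos v == q & sneg u v]].
have negE u v : neg (pos u) (pos v) = sneg u v.
  apply/existsP/idP => [[x /existsP[y /and3P[/eqP/pos_inj-> /eqP/pos_inj->]]] //|uv].
  by exists u; apply/existsP; exists v; rewrite !eqxx.
have [f fP] := brick_wall_map neg.
exists (f \o pos) => u v uv.
suff /andP[-> /eqP->] : signed_adj (sneg u v) (f (pos u)) (f (pos v)) by [].
have [/fP|/fP] := posP u v uv; first by rewrite negE.
by rewrite negE sneg_sym signed_adjC.
Qed.

End BrickWallMap.

(** * The hexagonal tiling as a brick wall *)

Section HexagonalTiling.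
Local Open Scope ring_scope.

Definition hex_directions : seq plane_point :=
  [:: (1, 0); (0, 1); (-1, 1); (-1, 0); (0, -1); (1, -1)].

Lemma iter_rot60_direction k : iter k rot60 (1, 0) \in hex_directions.
Proof.
have /allP rot60_dir : all (fun d => rot60 d \in hex_directions) hex_directions.
  by [].
by elim: k => //= k; apply: rot60_dir.
Qed.

Lemma hex_vertex_mod3 p : hex_vertex p -> ~~ (3 %| p.1 - p.2)%Z.
Proof.
move=> [i [j [k ->]]]; rewrite /hex_corner /hex_center /=.
move: (iter_rot60_direction k); rewrite !inE.
by do 5?[case/predU1P=> [->|]] => [|||||/eqP->] /=; lia.
Qed.

(* Edges are oriented away from the colour class p.1 - p.2 = 1 modulo 3 of the
   bipartite tiling. *)
Definition hex_arc (p q : plane_point) : Prop :=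
  (3 %| p.1 - p.2 - 1)%Z /\
  [\/ q = (p.1 + 1, p.2), q = (p.1 - 1, p.2 + 1) | q = (p.1, p.2 - 1)].

Lemma hex_adj_arc p q : hex_adj p q -> hex_arc p q \/ hex_arc q p.
Proof.
suff arc i j k : hex_arc (hex_corner i j k) (hex_corner i j k.+1) \/
                 hex_arc (hex_corner i j k.+1) (hex_corner i j k).
  move=> [i [j [k [[-> ->]|[-> ->]]]]]; first exact: arc.
  by case: (arc i j k); [right|left].
rewrite /hex_corner /hex_center /hex_arc /=.
move: (iter_rot60_direction k); rewrite !inE.
do 5?[case/predU1P=> [->|]] => [|||||/eqP->] /=.
- left; split; first lia.
  by constructor 2; congr pair; lia.
- right; split; first lia.
  by constructor 1; congr pair; lia.
- left; split; first lia.
  by constructor 3; congr pair; lia.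
- right; split; first lia.
  by constructor 2; congr pair; lia.
- left; split; first lia.
  by constructor 1; congr pair; lia.
- right; split; first lia.
  by constructor 3; congr pair; lia.
Qed.

Lemma hex_adj_sym p q : hex_adj p q -> hex_adj q p.
Proof. by move=> [i [j [k [pq|qp]]]]; exists i, j, k; [right|left]. Qed.

Lemma hex_adj_irr p : ~ hex_adj p p.
Proof. by case: p => a b /hex_adj_arc[] [_ [] []]; lia. Qed.

Definition norm1_le (M : nat) (p : plane_point) : Prop :=
  (`|p.1| + `|p.2| <= M)%N.

(* Rows follow the steps e1 and e2 alternately, row r consisting of the points
   with a - b = 3 r + 1 or 3 r + 2.  The shifts keep parities and make both
   coordinates nonnegative within distance M of the origin. *)
Definition brick_pos (M : nat) (p : plane_point) : nat * nat :=
  (absz (p.1 + p.2 + (2 * M)%:Z), (absz (p.1 - p.2 + (6 * M)%:Z)%R %/ 3)%N).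

Lemma brick_pos_inj M p q : norm1_le M p -> norm1_le M q ->
  hex_vertex p -> hex_vertex q -> brick_pos M p = brick_pos M q -> p = q.
Proof.
case: p q => [a b] [a' b']; rewrite /norm1_le /brick_pos /=.
move=> Mp Mq /hex_vertex_mod3/= p3 /hex_vertex_mod3/= q3 [col row].
by congr pair; lia.
Qed.

Lemma hex_arc_brick_adj M p q : norm1_le M p -> norm1_le M q -> hex_arc p q ->
  brick_adj (brick_pos M p) (brick_pos M q).
Proof.
rewrite /norm1_le /brick_adj /brick_edge /brick_pos.
case: p q => [a b] q /= Mp + [/= p3 qE]; case: qE => -> /= Mq.
- by left; left; congr pair; lia.
- by right; right; split; first congr pair; lia.
- by right; left; congr pair; lia.
Qed.

Lemma hexagonal_grid_brick (V : finType) (e : rel V) : hexagonal_grid e ->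
  exists f : V -> nat * nat,
    injective f /\ forall u v, e u v -> brick_adj (f u) (f v).
Proof.
move=> [pos [pos_inj pos_hex pos_adj]].
pose norm1 v := (`|(pos v).1| + `|(pos v).2|)%N.
pose M := \max_v norm1 v.
have posM v : norm1_le M (pos v) by exact: (@leq_bigmax _ norm1 v).
exists (brick_pos M \o pos); split.
  by move=> u v /(brick_pos_inj (posM u) (posM v) (pos_hex u) (pos_hex v)) /pos_inj.
move=> u v /pos_adj/hex_adj_arc[uv|vu]; first exact: hex_arc_brick_adj.
by have [] := hex_arc_brick_adj (posM v) (posM u) vu; [right|left].
Qed.

End HexagonalTiling.

Lemma signed_hexagonal_grid_hom_K4 (G : signed_graph) :
  signed_hexagonal_grid G -> hom_to_order G 4.
Proof.
move=> /hexagonal_grid_brick[pos [pos_inj posP]].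
have K4_walks3 := double_switch_all_signs_walks3 K4_both_sign_walks3.
have [f fP] := brick_wall_hom K4_walks3 ((false, false), false) pos_inj posP.
exists K4; split; first by rewrite card_prod card_bool.
by exists (fun v => (f v).1); apply: double_switch_signed_hom.
Qed.

(** * A hexagon with one negative edge *)

Definition hexagon_pos (u : 'I_6) : plane_point := hex_corner 0 0 u.

Definition hexagon_edge : rel 'I_6 :=
  fun u v => `[< hex_adj (hexagon_pos u) (hexagon_pos v) >].

(* The only negative edge joins the corners 1 and 2. *)
Definition hexagon_neg : rel 'I_6 := fun u v => u * v == 2.

Lemma hexagon_edge_sym : symmetric hexagon_edge.
Proof. by move=> u v; apply/asboolP/asboolP; apply: hex_adj_sym. Qed.

Lemma hexagon_edge_irr : irreflexive hexagon_edge.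
Proof. by move=> u; apply/asboolP; apply: hex_adj_irr. Qed.

Lemma hexagon_neg_sym : symmetric hexagon_neg.
Proof. by move=> u v; rewrite /hexagon_neg mulnC. Qed.

Definition hexagon : signed_graph :=
  SignedGraph hexagon_edge_sym hexagon_edge_irr hexagon_neg_sym.

Lemma hexagon_pos_inj : injective hexagon_pos.
Proof.
apply/injectiveP; rewrite /injectiveb /dinjectiveb.
by rewrite (map_comp (hex_corner 0 0) val) val_enum_ord.
Qed.

Lemma hexagon_grid : signed_hexagonal_grid hexagon.
Proof.
exists hexagon_pos; split; first exact: hexagon_pos_inj.
- by move=> v; exists 0%R, 0%R, v.
- by move=> u v; split=> /asboolP.
Qed.

Lemma hexagon_edge_ordS (u : 'I_6) : hexagon_edge u (ordS u).
Proof.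
apply/asboolP; exists 0%R, 0%R, u; left; split=> //.
by case: u => -[|[|[|[|[|[|]]]]]].
Qed.

Lemma hexagon_chi_s_gt3 : 3 < chi_s hexagon.
Proof.
pose p : seq hexagon := traject (@ordS 6) (ordS ord0) 6.
have := @negative_even_closed_walk_chi_s hexagon ord0 p; apply=> //.
- apply: sub_path (fpath_traject _ _ _) => u _ /eqP<-.
  exact: hexagon_edge_ordS.
- by rewrite last_traject; apply/val_inj.
Qed.

Theorem theorem2 : class_chromatic_number signed_hexagonal_grid 4.
Proof.
have chi_s_le4 G : signed_hexagonal_grid G -> chi_s G <= 4.
  by move=> gridG; apply/chi_s_leq/signed_hexagonal_grid_hom_K4.
split=> //; exists hexagon; split; first exact: hexagon_grid.
by apply/eqP; rewrite eqn_leq hexagon_chi_s_gt3 chi_s_le4 //; apply: hexagon_grid.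
Qed.
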